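(* Let $q\in\mathbb{R}^n$, let $M\in\mathbb{R}^{n\times n}$ be a symmetric positive definite matrix, let $\beta>0$ and put $M_\beta=\beta M$. Then, for any starting point $y^0\in\mathbb{R}^n$, the semi-smooth Newton sequence $\{y^k\}$ generated by $$\big[[M_\beta-\mathrm{Id}_n]V(y^k)+\mathrm{Id}_n\big]y^{k+1}=-\beta q,\qquad V(y^k)\in\partial_BP_{\mathcal K}(y^k),\qquad k=0,1,\ldots,$$ is well-defined. Moreover, if $0<\beta<2/\|M\|$, then the equation $$[M_\beta-\mathrm{Id}_n]P_{\mathcal K}(y)+y=-\beta q,\qquad y\in\mathbb{R}^n,$$ has a unique solution $y^*\in\mathbb{R}^n$. Additionally, if $\|M\|\,\|M^{-1}\|<3$ and $$\frac12\|M^{-1}\|<\beta<\frac32\,\frac1{\|M\|},$$ then the sequence $\{y^k\}$ converges $Q$-linearly to $y^*$, the unique solution of this equation, as follows: $$\|y^*-y^{k+1}\|\le\frac{\|M_\beta-\mathrm{Id}_n\|}{1-\|M_\beta-\mathrm{Id}_n\|}\,\|y^*-y^k\|,\qquad k=0,1,\ldots.$$ Furthermore, $P_{\mathcal K}(y^* )$ is a solution of the linear second order cone complementarity problem: find $z\in\mathbb{R}^n$ such that $z\in\mathcal K$, $Mz+q\in\mathcal K$ and $\langle Mz+q,z\rangle=0$.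
   Context: $\mathbb{R}^n$ carries the canonical inner product $\langle\cdot,\cdot\rangle$ and Euclidean norm $\|\cdot\|$; for a matrix $E\in\mathbb{R}^{n\times n}$, $\|E\|=\max\{\|Ex\|: \|x\|=1\}$; $\mathrm{Id}_n$ is the $n\times n$ identity matrix. $\mathcal K=\{x=(x_1,x_2)\in\mathbb{R}\times\mathbb{R}^{n-1}: \|x_2\|\le x_1\}$ is the second order cone and $P_{\mathcal K}$ is the Euclidean metric projection onto $\mathcal K$. For a locally Lipschitz map $F:\mathbb{R}^n\to\mathbb{R}^m$, with $D_F$ the set of points where $F$ is differentiable and $F'$ its Jacobian, the B-subdifferential is $\partial_BF(x)=\{V\in\mathbb{R}^{m\times n}: \exists\,\{x^k\}\subset D_F,\ x^k\to x,\ F'(x^k)\to V\}$. In the Newton iteration $V(y^k)$ is an arbitrary element of $\partial_BP_{\mathcal K}(y^k)$; ''well-defined'' means that the linear system at each step has a nonsingular matrix, so that $y^{k+1}$ exists and is unique, whatever the choice of $V(y^k)$. *)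

(* Defs.v *)
From HB Require Import structures.
From mathcomp Require Import all_boot all_order all_algebra.
From mathcomp Require Import all_classical all_reals all_analysis.

Set Implicit Arguments.
Unset Strict Implicit.
Unset Printing Implicit Defensive.

Import Order.TTheory GRing.Theory Num.Theory.
Import numFieldNormedType.Exports.

Local Open Scope classical_set_scope.
Local Open Scope ring_scope.

Section Euclidean.
Context {R : realType}.

Definition dotv n (x y : 'cV[R]_n) : R := \sum_i x i 0 * y i 0.

(* The norm `|x| that the library puts on matrices is the max norm; it induces
   the same topology, so convergence and differentiability below may refer to
   it, but every norm in a formula has to be this one. *)
Definition enorm n (x : 'cV[R]_n) : R := Num.sqrt (dotv x x).

(* The supremum is a maximum, by compactness of the unit sphere; the dimension
   is a successor so that the sphere is nonempty. *)
Definition opnorm n (E : 'M[R]_n.+1) : R :=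
  sup [set enorm (E *m x) | x in [set x : 'cV[R]_n.+1 | enorm x = 1]].

Definition posdefmx n (M : 'M[R]_n) : Prop :=
  forall x : 'cV[R]_n, x != 0 -> 0 < dotv (M *m x) x.

(* row' ord0 x is x without its first entry, hence empty when n = 0, in which
   case the cone is the half-line of nonnegative numbers. *)
Definition soc n : set 'cV[R]_n.+1 :=
  [set x | enorm (row' ord0 x) <= x ord0 0].

(* Metric projection onto C; it is meaningful when the nearest point exists and
   is unique, as it is for a nonempty closed convex C. *)
Definition metric_proj n (C : set 'cV[R]_n) (x : 'cV[R]_n) : 'cV[R]_n :=
  xget 0 [set p | C p /\ forall z, C z -> enorm (x - p) <= enorm (x - z)].

Definition soc_proj n : 'cV[R]_n.+1 -> 'cV[R]_n.+1 := metric_proj (@soc n).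

End Euclidean.

Section BSubdifferential.
Context {R : realType}.

(* The library's jacobian is for row vectors, with 'd F x h = h *m 'J F x; for
   column vectors the usual convention is the one stated in jacMv_mul. *)
Definition jacMv m n (F : 'cV[R]_n -> 'cV[R]_m) (x : 'cV[R]_n) : 'M[R]_(m, n) :=
  \matrix_(i, j) 'd F x (delta_mx j 0) i 0.

Lemma jacMv_mul m n (F : 'cV[R]_n -> 'cV[R]_m) (x h : 'cV[R]_n) :
  'd F x h = jacMv F x *m h.
Proof.
rewrite {1}[h]matrix_sum_delta.
under eq_bigr do rewrite big_ord1.
rewrite linear_sum /=; apply/matrixP => i k; rewrite summxE mxE (ord1 k).
by apply: eq_bigr => j _; rewrite linearZ /= !mxE mulrC.
Qed.

Definition Bsubdiff m n (F : 'cV[R]_n -> 'cV[R]_m) (x : 'cV[R]_n) :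
    set 'M[R]_(m, n) :=
  [set V | exists x_ : nat -> 'cV[R]_n,
     [/\ forall k, differentiable F (x_ k),
         x_ k @[k --> \oo] --> x
       & jacMv F (x_ k) @[k --> \oo] --> V]].

End BSubdifferential.

Section Newton.
Context {R : realType}.

Definition newton_mx n (Mb V : 'M[R]_n) : 'M[R]_n := (Mb - 1%:M) *m V + 1%:M.

Definition newton_step n (Mb : 'M[R]_n.+1) (b y z : 'cV[R]_n.+1) : Prop :=
  exists2 V, Bsubdiff (@soc_proj R n) y V & newton_mx Mb V *m z = b.

Definition newton_seq n (Mb : 'M[R]_n.+1) (b : 'cV[R]_n.+1)
    (y : nat -> 'cV[R]_n.+1) : Prop :=
  forall k, newton_step Mb b (y k) (y k.+1).

(* Whatever the choices made in the first k steps, step k can be carried out,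
   and each admissible V yields a nonsingular system. *)
Definition newton_well_defined n (Mb : 'M[R]_n.+1) (b y0 : 'cV[R]_n.+1) : Prop :=
  forall (k : nat) (y : nat -> 'cV[R]_n.+1), y 0%N = y0 ->
    (forall j, (j < k)%N -> newton_step Mb b (y j) (y j.+1)) ->
    Bsubdiff (@soc_proj R n) (y k) !=set0 /\
    forall V, Bsubdiff (@soc_proj R n) (y k) V ->
      newton_mx Mb V \in unitmx /\ exists! z, newton_mx Mb V *m z = b.

Definition projection_eqn n (Mb : 'M[R]_n.+1) (b y : 'cV[R]_n.+1) : Prop :=
  (Mb - 1%:M) *m soc_proj y + y = b.

Definition Qlinear_cvg n (y : nat -> 'cV[R]_n) (ystar : 'cV[R]_n) : Prop :=
  y k @[k --> \oo] --> ystar /\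
  exists2 c : R, 0 <= c < 1 &
    \forall k \near \oo, enorm (ystar - y k.+1) <= c * enorm (ystar - y k).

Definition lsoccp_sol n (M : 'M[R]_n.+1) (q z : 'cV[R]_n.+1) : Prop :=
  [/\ soc z, soc (M *m z + q) & dotv (M *m z + q) z = 0].

End Newton.

(* Main.v *)
(* Let P = soc_proj.  It is positively homogeneous and firmly nonexpansive, and
   both properties pass to Jacobians and to their limits: every V in the
   B-subdifferential at y satisfies V y = P(y) and |V h|^2 <= <V h, h>.  The
   inequality makes the Newton systems nonsingular, as u = V h then satisfies
   <M_beta u, u> <= 0 for h in the kernel.  Moreover P - id/2 and V - id/2 are
   1/2-Lipschitz, so that |V x - P(x)| = |V (x - y) - (P(x) - P(y))| <= |x - y|,
   where the triangle inequality alone would lose a factor 2; this gives the rate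
   r / (1 - r) with r = |M_beta - Id|.  The conditions on beta give r < 1,
   respectively r < 1/2.  Nonemptiness of the B-subdifferential is explicit:
   away from the boundary of the cone and of its polar, P is differentiable; at
   a boundary point the identity or 0 is a limit of Jacobians along the axis. *)
Require Import Defs.
From HB Require Import structures.
From mathcomp Require Import all_boot all_order all_algebra.
From mathcomp Require Import all_classical all_reals all_analysis.
From mathcomp Require Import ring lra.

Set Implicit Arguments.
Unset Strict Implicit.
Unset Printing Implicit Defensive.

Import Order.TTheory GRing.Theory Num.Theory.
Import numFieldNormedType.Exports.

Local Open Scope classical_set_scope.
Local Open Scope ring_scope.

(** * Euclidean inner product, norm and operator norm *)

Section EuclideanTheory.
Context {R : realType}.

Section Dotv.
Context {n : nat}.
Implicit Types (x y z : 'cV[R]_n) (a : R).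

Lemma dotvC x y : dotv x y = dotv y x.
Proof. by apply: eq_bigr => i _; rewrite mulrC. Qed.

Lemma dotvDl x y z : dotv (x + y) z = dotv x z + dotv y z.
Proof. by rewrite -big_split; apply: eq_bigr => i _; rewrite mxE mulrDl. Qed.

Lemma dotvZl a x y : dotv (a *: x) y = a * dotv x y.
Proof. by rewrite mulr_sumr; apply: eq_bigr => i _; rewrite mxE mulrA. Qed.

Lemma dotvNl x y : dotv (- x) y = - dotv x y.
Proof. by rewrite -scaleN1r dotvZl mulN1r. Qed.

Lemma dotvDr x y z : dotv z (x + y) = dotv z x + dotv z y.
Proof. by rewrite !(dotvC z) dotvDl. Qed.

Lemma dotvZr a x y : dotv y (a *: x) = a * dotv y x.
Proof. by rewrite !(dotvC y) dotvZl. Qed.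

Lemma dotvNr x y : dotv y (- x) = - dotv y x.
Proof. by rewrite !(dotvC y) dotvNl. Qed.

Lemma dotv0l x : dotv 0 x = 0.
Proof. by rewrite -(scale0r 0) dotvZl mul0r. Qed.

Definition dotvE := (dotvDl, dotvDr, dotvNl, dotvNr, dotvZl, dotvZr).

Lemma dotv_ge0 x : 0 <= dotv x x.
Proof. by apply: sumr_ge0 => i _; rewrite -expr2 sqr_ge0. Qed.

Lemma dotv_eq0 x : dotv x x = 0 -> x = 0.
Proof.
move=> /eqP; rewrite psumr_eq0 => [/allP h|i _]; last by rewrite -expr2 sqr_ge0.
apply/colP => i; have := h i (mem_index_enum i).
by rewrite mulf_eq0 orbb mxE => /eqP.
Qed.

Lemma enorm_ge0 x : 0 <= enorm x.
Proof. exact: sqrtr_ge0. Qed.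

Lemma enorm_sqr x : enorm x ^+ 2 = dotv x x.
Proof. by rewrite sqr_sqrtr ?dotv_ge0. Qed.

Lemma enorm0_eq0 x : enorm x = 0 -> x = 0.
Proof. by move=> h; apply: dotv_eq0; rewrite -enorm_sqr h expr0n. Qed.

Lemma enorm0 : enorm (0 : 'cV[R]_n) = 0.
Proof. by rewrite /enorm dotv0l sqrtr0. Qed.

Lemma enorm_gt0 x : x != 0 -> 0 < enorm x.
Proof.
by rewrite lt_def enorm_ge0 andbT; apply: contra_neq => /enorm0_eq0.
Qed.

Lemma enorm_le x a : 0 <= a -> (enorm x <= a) = (dotv x x <= a ^+ 2).
Proof. by move=> a0; rewrite -enorm_sqr ler_sqr// nnegrE enorm_ge0. Qed.

Lemma enormZ a x : enorm (a *: x) = `|a| * enorm x.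
Proof.
by rewrite /enorm !dotvE mulrA -expr2 sqrtrM ?sqr_ge0// sqrtr_sqr.
Qed.

Lemma enormN x : enorm (- x) = enorm x.
Proof. by rewrite -scaleN1r enormZ normrN1 mul1r. Qed.

(** Cauchy-Schwarz: the square of [enorm y *: x - enorm x *: y] is nonnegative and factors through
    the positive number [enorm x * enorm y], which is then cancelled. *)
Lemma dotv_le_enorm x y : dotv x y <= enorm x * enorm y.
Proof.
have [->|x0] := eqVneq x 0; first by rewrite dotv0l enorm0 mul0r.
have [->|y0] := eqVneq y 0; first by rewrite dotvC dotv0l enorm0 mulr0.
have := dotv_ge0 (enorm y *: x - enorm x *: y).
rewrite !dotvE -!enorm_sqr (dotvC y x) => h.
have {}h : 0 <= enorm x * enorm y * (enorm x * enorm y - dotv x y) by nra.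
by rewrite -subr_ge0 -(pmulr_rge0 _ (mulr_gt0 (enorm_gt0 x0) (enorm_gt0 y0))).
Qed.

Lemma dotv_ge_Nenorm x y : - (enorm x * enorm y) <= dotv x y.
Proof. by rewrite -enormN lerNl -dotvNl dotv_le_enorm. Qed.

Lemma enormD x y : enorm (x + y) <= enorm x + enorm y.
Proof.
rewrite enorm_le ?addr_ge0 ?enorm_ge0// sqrrD !enorm_sqr !dotvE (dotvC y x).
have := dotv_le_enorm x y; lra.
Qed.

Lemma dotv_mxl (A : 'M[R]_n) x y : dotv (A *m x) y = dotv x (A^T *m y).
Proof.
have dotvEmx (u v : 'cV[R]_n) : dotv u v = (u^T *m v) 0 0.
  by rewrite mxE; apply: eq_bigr => i _; rewrite mxE.
by rewrite !dotvEmx trmx_mul mulmxA.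
Qed.

End Dotv.

Section Opnorm.
Context {n : nat}.
Implicit Types (x y : 'cV[R]_n.+1) (E : 'M[R]_n.+1).

Lemma dotv_delta : dotv (delta_mx ord0 0 : 'cV[R]_n.+1) (delta_mx ord0 0) = 1.
Proof.
rewrite /dotv big_ord_recl big1 => [|i _]; rewrite !mxE/= ?mul0r//.
by rewrite mulr1 addr0.
Qed.

Let unit_sphere_image E :=
  [set enorm (E *m x) | x in [set x : 'cV[R]_n.+1 | enorm x = 1]].

Let sphere_nonempty E : unit_sphere_image E !=set0.
Proof.
exists (enorm (E *m delta_mx ord0 0)), (delta_mx ord0 0) => //=.
by rewrite /enorm dotv_delta sqrtr1.
Qed.

Lemma opnorm_le E c : (forall x, enorm (E *m x) <= c * enorm x) ->
  opnorm E <= c.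
Proof.
move=> Ec; apply: ge_sup; first exact: sphere_nonempty.
by move=> _ [x /= x1 <-]; rewrite (le_trans (Ec x))// x1 mulr1.
Qed.

Lemma enorm_mulmx E x : enorm (E *m x) <= opnorm E * enorm x.
Proof.
have [->|x0] := eqVneq x 0; first by rewrite mulmx0 enorm0 mulr0.
have xgt0 := enorm_gt0 x0.
rewrite -ler_pdivrMr// mulrC -[X in X * _]ger0_norm ?invr_ge0 ?enorm_ge0//.
rewrite -enormZ scalemxAr; apply: ub_le_sup; last first.
  exists ((enorm x)^-1 *: x) => //=.
  by rewrite enormZ ger0_norm ?invr_ge0 ?enorm_ge0// mulVf// gt_eqF.
(* The Frobenius norm bounds the set whose supremum is [opnorm E], by Cauchy-Schwarz on each row. *)
exists (Num.sqrt (\sum_i dotv (row i E)^T (row i E)^T)) => _ [y /= y1 <-].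
apply: ler_wsqrtr; apply: ler_sum => i _.
have -> : (E *m y) i 0 = dotv (row i E)^T y.
  by rewrite mxE; apply: eq_bigr => j _; rewrite !mxE.
set r := (row i E)^T; rewrite -expr2 -[leRHS]enorm_sqr.
have := dotv_le_enorm r y; have := dotv_ge_Nenorm r y.
rewrite y1 mulr1; nra.
Qed.

Lemma opnorm_ge0 E : 0 <= opnorm E.
Proof.
have := enorm_mulmx E (delta_mx ord0 0).
rewrite [X in _ * X]/enorm dotv_delta sqrtr1 mulr1.
exact: le_trans (enorm_ge0 _).
Qed.

End Opnorm.
End EuclideanTheory.

(** * The cone, Moreau decompositions and the projection *)

Section SecondOrderCone.
Context {R : realType} {n : nat}.
Implicit Types (x y z p h : 'cV[R]_n.+1) (a : R).

Lemma dotv_soc_split x y :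
  dotv x y = x ord0 0 * y ord0 0 + dotv (row' ord0 x) (row' ord0 y).
Proof.
rewrite {1}/dotv big_ord_recl; congr (_ + _).
by apply: eq_bigr => i _; rewrite !mxE.
Qed.

(** Half of the self-duality of the cone: by Cauchy-Schwarz the tails contribute at least minus the
    product of the heads. *)
Lemma soc_dotv_ge0 x y : soc x -> soc y -> 0 <= dotv x y.
Proof.
rewrite /soc/= dotv_soc_split => xK yK.
have := dotv_ge_Nenorm (row' ord0 x) (row' ord0 y).
have := enorm_ge0 (row' ord0 x); have := enorm_ge0 (row' ord0 y); nra.
Qed.

Lemma socZ a x : 0 <= a -> soc x -> soc (a *: x).
Proof.
move=> a0; rewrite /soc/= linearZ/= enormZ mxE ger0_norm// => xK.
exact: ler_wpM2l.
Qed.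

(* Moreau's decomposition x = p - (p - x) *)
Definition soc_moreau x p := [/\ soc p, soc (p - x) & dotv (p - x) p = 0].

(** Self-duality and orthogonality give |x - p|^2 + |p - z|^2 <= |x - z|^2 for all z in the cone.
    This makes p a nearest point, and the only one, so the choice made by [xget] must be p. *)
Lemma soc_moreauP x p : soc_moreau x p -> soc_proj x = p.
Proof.
case=> pK pxK px0.
have best z : soc z -> dotv (x - p) (x - p) + dotv (p - z) (p - z)
                       <= dotv (x - z) (x - z).
  move=> /(soc_dotv_ge0 pxK); move: px0; rewrite !dotvE.
  rewrite !(dotvC x p) !(dotvC x z) !(dotvC p z) => px0 pz; lra.
have proj_p : soc p /\ forall z, soc z -> enorm (x - p) <= enorm (x - z).
  split=> // z /best; have := dotv_ge0 (p - z) => ? ?.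
  apply: ler_wsqrtr; lra.
rewrite /soc_proj /metric_proj; set P := [set _ | _].
have : P (xget 0 P) by apply: xgetPex; exists p.
move: (xget 0 P) => p' [p'K p'min].
have := p'min p pK; rewrite enorm_le ?enorm_ge0// enorm_sqr => le_p'p.
apply/eqP; rewrite eq_sym -subr_eq0; apply/eqP/dotv_eq0.
have := best p' p'K; have := dotv_ge0 (p - p'); lra.
Qed.

(** With x = (x1, x2) and s = |x2|, this is the spectral term (x1 + s)/2 (1, x2/s), the projection
    of points outside both the cone and its polar. *)
Definition soc_slant x : 'cV[R]_n.+1 :=
  let s := enorm (row' ord0 x) in
  ((x ord0 0 + s) / 2) *: delta_mx ord0 0 +
  ((x ord0 0 / s + 1) / 2) *: (x - x ord0 0 *: delta_mx ord0 0).

Lemma soc_moreau_slant x : `|x ord0 0| < enorm (row' ord0 x) ->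
  soc_moreau x (soc_slant x).
Proof.
set s := enorm _; rewrite ltr_norml => /andP[x0l x0r].
have s0 : 0 < s by lra.
have tl : row' ord0 (soc_slant x) = ((x ord0 0 / s + 1) / 2) *: row' ord0 x.
  apply/matrixP => i j; rewrite !mxE/= -/s; ring.
have hd : soc_slant x ord0 0 = (x ord0 0 + s) / 2.
  by rewrite !mxE/= !mulr1 subrr mulr0 addr0.
have tlB : row' ord0 (soc_slant x - x) =
    ((x ord0 0 / s + 1) / 2 - 1) *: row' ord0 x.
  by rewrite linearB/= tl scalerBl scale1r.
have q1 : x ord0 0 / s < 1 by rewrite ltr_pdivrMr// mul1r.
have q2 : -1 < x ord0 0 / s by rewrite ltr_pdivlMr// mulN1r.
split.
- rewrite /soc/= tl enormZ hd ger0_norm; last lra.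
  by rewrite -/s le_eqVlt; apply/orP; left; apply/eqP; field; rewrite gt_eqF.
- rewrite /soc/= tlB enormZ.
  rewrite ler0_norm; last lra.
  rewrite mxE hd -/s mxE le_eqVlt; apply/orP; left; apply/eqP; field.
  by rewrite gt_eqF.
- rewrite dotv_soc_split tlB tl mxE hd mxE !dotvE -enorm_sqr -/s.
  by field; rewrite gt_eqF.
Qed.

Lemma soc_moreau_id x : soc x -> soc_moreau x x.
Proof.
move=> xK; split=> //; rewrite subrr ?dotv0l//.
by rewrite /soc/= linear0 enorm0 mxE.
Qed.

Lemma soc_moreau_polar x : soc (- x) -> soc_moreau x 0.
Proof.
by move=> xK; split; rewrite ?add0r ?(dotvC _ 0) ?dotv0l// /soc/=
  linear0 enorm0 mxE.
Qed.

(** Existence of the nearest point is explicit: x in the cone, x in the polar, or the slanted region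
    between them. *)
Lemma soc_proj_moreau x : soc_moreau x (soc_proj x).
Proof.
suff [p pP] : exists p, soc_moreau x p by rewrite (soc_moreauP pP).
have [xK|xNK] := leP (enorm (row' ord0 x)) (x ord0 0).
  by exists x; exact: soc_moreau_id.
have [xpolar|xNpolar] := leP (enorm (row' ord0 x)) (- x ord0 0).
  exists 0; apply: soc_moreau_polar.
  by rewrite /soc/= linearN/= enormN mxE.
exists (soc_slant x); apply: soc_moreau_slant.
by rewrite ltr_norml xNK andbT ltrNl.
Qed.

Lemma soc_projZ a x : 0 <= a -> soc_proj (a *: x) = a *: soc_proj x.
Proof.
move=> a0; have [pK pxK px0] := soc_proj_moreau x; apply: soc_moreauP.
rewrite /soc_moreau -scalerBr; split; try exact: socZ.
by rewrite dotvZl dotvZr px0 !mulr0.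
Qed.

(** With p and q the projections of x and y, self-duality gives <p, q - y> >= 0 and <q, p - x> >= 0;
    adding them and using <p - x, p> = <q - y, q> = 0 gives the claim. *)
Lemma soc_proj_firm x y :
  dotv (soc_proj x - soc_proj y) (soc_proj x - soc_proj y)
  <= dotv (soc_proj x - soc_proj y) (x - y).
Proof.
have [pK pxK px0] := soc_proj_moreau x; have [qK qyK qy0] := soc_proj_moreau y.
move: (soc_dotv_ge0 pK qyK) (soc_dotv_ge0 qK pxK) px0 qy0.
move: (soc_proj x) (soc_proj y) => p q; rewrite !dotvE.
rewrite (dotvC q p) (dotvC x p) (dotvC y q); lra.
Qed.

(** Completing the square: firmness says that x lies in the ball with centre h/2 and radius
    |h|/2. *)
Lemma firm_half_enorm x h : dotv x x <= dotv x h ->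
  enorm (x - 2^-1 *: h) <= 2^-1 * enorm h.
Proof.
move=> xh; have h0 := enorm_ge0 h; rewrite enorm_le; last lra.
rewrite exprMn enorm_sqr !dotvE (dotvC h x); lra.
Qed.

Lemma firm_enorm x h : dotv x x <= dotv x h -> enorm x <= enorm h.
Proof.
move=> /firm_half_enorm xh.
rewrite -[x](subrK (2^-1 *: h)) (le_trans (enormD _ _))// enormZ ger0_norm; lra.
Qed.

End SecondOrderCone.

(** * Coordinatewise limits and locality of the differential *)

Section MatrixConvergence.
Context {R : realType}.

Section Coordinates.
Context {T : Type} {F : set_system T} {FF : Filter F}.

Lemma cvg_coord m n (A_ : T -> 'M[R]_(m, n)) (A : 'M[R]_(m, n)) i j :
  A_ t @[t --> F] --> A -> A_ t i j @[t --> F] --> A i j.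
Proof.
move=> AA; apply: (@continuous_cvg _ _ _ F FF A_ (fun M => M i j) A _ AA).
exact: coord_continuous.
Qed.

Lemma cvg_dotv n (x_ y_ : T -> 'cV[R]_n) (x y : 'cV[R]_n) :
  (forall i, x_ t i 0 @[t --> F] --> x i 0) ->
  (forall i, y_ t i 0 @[t --> F] --> y i 0) ->
  dotv (x_ t) (y_ t) @[t --> F] --> dotv x y.
Proof.
move=> xx yy; apply: cvg_big => [|i _]; first exact: add_continuous.
exact: cvgM (xx i) (yy i).
Qed.

Lemma cvg_enorm n (x_ : T -> 'cV[R]_n) (x : 'cV[R]_n) :
  (forall i, x_ t i 0 @[t --> F] --> x i 0) ->
  enorm (x_ t) @[t --> F] --> enorm x.
Proof.
move=> xx; have sqrt_cvg : {for dotv x x, continuous (@Num.sqrt R)}.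
  exact: sqrt_continuous.
exact: (@continuous_cvg _ _ _ F FF _ Num.sqrt _ sqrt_cvg (cvg_dotv xx xx)).
Qed.

Lemma cvg_mulmx_coord m n p (A_ : T -> 'M[R]_(m, n)) (B_ : T -> 'M[R]_(n, p))
    (A : 'M[R]_(m, n)) (B : 'M[R]_(n, p)) i j :
  A_ t @[t --> F] --> A -> B_ t @[t --> F] --> B ->
  (A_ t *m B_ t) i j @[t --> F] --> (A *m B) i j.
Proof.
move=> AA BB; under eq_fun do rewrite mxE; rewrite mxE.
apply: cvg_big => [|k _]; first exact: add_continuous.
by apply: cvgM; exact: cvg_coord.
Qed.

End Coordinates.

Section EuclideanNorm.
Context {n : nat}.
Implicit Types x : 'cV[R]_n.

Lemma coord_le_enorm x i : `|x i 0| <= enorm x.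
Proof.
rewrite -sqrtr_sqr ler_wsqrtr// expr2 /dotv (bigD1 i)//= lerDl.
by apply: sumr_ge0 => j _; rewrite -expr2 sqr_ge0.
Qed.

Lemma norm_le_enorm x : `|x| <= enorm x.
Proof.
rewrite [`|x|]mx_normrE; apply: bigmax_le; first exact: enorm_ge0.
by move=> [i j] _; rewrite (ord1 j)/= coord_le_enorm.
Qed.

End EuclideanNorm.

(** Carries derivatives from local formulas over to the projection: the first-order expansion of g
    at x is also one of f, and the differential is unique. *)
Lemma near_eq_diff (V W : normedModType R) (f g : V -> W) (x : V) :
  (\forall y \near x, f y = g y) -> differentiable g x ->
  differentiable f x /\ 'd f x = 'd g x :> (V -> W).
Proof.
move=> fg gx; have [dgc gE] := (diff_locallyP x g).1 gx.
have fE : f \o shift x = cst (f x) + 'd g x +o_ 0 id.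
  apply/eqaddoP => e e0; have /eqaddoP/(_ e e0) := gE.
  have : \forall h \near 0, f (h + x) = g (h + x).
    by have := fg; rewrite (near_shift 0); apply: filterS => h; rewrite /= subr0.
  have fgx := nbhs_singleton fg.
  by apply: filterS2 => h /= fgh; rewrite /shift/= !fctE fgh fgx.
have dfg : 'd f x = 'd g x :> (V -> W).
  by apply: diff_unique; [exact: dgc | exact: fE].
split; last exact: dfg.
by apply/diff_locallyP; rewrite dfg; split; [exact: dgc | exact: fE].
Qed.

Lemma coord_differentiable (V : normedModType R) m (f : V -> 'cV[R]_m) (x : V) :
  (forall i, differentiable (fun y : V => f y i 0) x) -> differentiable f x.
Proof.
move=> fi; rewrite (_ : f = \sum_i (fun y : V => f y i 0 *: delta_mx i 0)).
  by apply: differentiable_sum => i; exact: differentiableZl.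
apply/funext => y; rewrite fct_sumE {1}[f y]matrix_sum_delta.
by apply: eq_bigr => i _; rewrite big_ord1.
Qed.

Lemma cvg_lt_near (T : topologicalType) (f g : T -> R) (x : T) :
  f @ x --> f x -> g @ x --> g x -> f x < g x -> \forall y \near x, f y < g y.
Proof.
move=> fx gx fgx; near=> y; rewrite -subr_gt0; near: y.
by apply: (cvgr_gt _ (cvgB gx fx)); rewrite subr_gt0.
Unshelve. all: by end_near. Qed.

End MatrixConvergence.

(** * Local formulas for the projection on its three open regions *)

Section SecondOrderConeDifferential.
Context {R : realType} {n : nat}.
Implicit Types (x y z p h : 'cV[R]_n.+1) (a : R).

Let tl_dotv_diff x : differentiable
  (fun y : 'cV[R]_n.+1 => dotv (row' ord0 y) (row' ord0 y)) x.
Proof.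
rewrite (_ : (fun _ => _) =
    \sum_(i < n) (fun y : 'cV[R]_n.+1 => y (lift ord0 i) 0 * y (lift ord0 i) 0)).
  apply: differentiable_sum => i; apply: differentiableM;
  exact: differentiable_coord.
by apply/funext => y; rewrite fct_sumE; apply: eq_bigr => i _; rewrite !mxE.
Qed.

Let tl_enorm_cvg x :
  (fun y : 'cV[R]_n.+1 => enorm (row' ord0 y)) @ x --> enorm (row' ord0 x).
Proof.
apply: (@cvg_enorm R _ (nbhs x) (nbhs_filter x)) => i.
under eq_cvg do rewrite !mxE; rewrite !mxE.
exact: (@coord_continuous R n.+1 1 (lift ord0 i) 0 x).
Qed.

Let hd_cvg x : (fun y : 'cV[R]_n.+1 => y ord0 0) @ x --> x ord0 0.
Proof. exact: coord_continuous. Qed.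

Lemma soc_slant_diff x : row' ord0 x != 0 -> differentiable (@soc_slant R n) x.
Proof.
move=> x0; have s0 := enorm_gt0 x0.
have s_diff : differentiable (fun y : 'cV[R]_n.+1 => enorm (row' ord0 y)) x.
  apply: (@differentiable_comp _ _ _ _ _ Num.sqrt _ (tl_dotv_diff x)).
  apply/derivable1_diffP; apply: ex_derive; apply: is_derive1_sqrt.
  by rewrite -enorm_sqr exprn_gt0.
apply: coord_differentiable => i.
(* Each coordinate is a polynomial in the entries of y, the norm of its tail and the inverse of that
   norm; the indicator of [i == ord0] encodes the axis vector. *)
rewrite (_ : (fun _ => _) = fun y : 'cV[R]_n.+1 =>
   (y ord0 0 + enorm (row' ord0 y)) * (2^-1 * (i == ord0)%:R) +
   (y ord0 0 * (enorm (row' ord0 y))^-1 + 1) *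
   (2^-1 * (y i 0 - y ord0 0 * (i == ord0)%:R))); last first.
  by apply/funext => y; rewrite !mxE/= andbT; ring.
have hd_diff := differentiable_coord x ord0 0.
have i_diff := differentiable_coord x i 0.
have sV_diff := differentiableV s_diff (lt0r_neq0 s0).
have cst_diff (c : R) := differentiable_cst c x.
by apply: differentiableD; apply: differentiableM => //;
  [exact: differentiableD | apply: differentiableD => //; exact: differentiableM
  | apply: differentiableM => //; apply: differentiableB => //;
    exact: differentiableM].
Qed.

Lemma soc_proj_id_near x : enorm (row' ord0 x) < x ord0 0 ->
  \forall y \near x, soc_proj y = y.
Proof.
move=> /(cvg_lt_near (@tl_enorm_cvg x) (@hd_cvg x)) xK; near=> y.
apply/soc_moreauP/soc_moreau_id/ltW; near: y; exact: xK.
Unshelve. all: by end_near. Qed.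

Lemma soc_proj_polar_near x : enorm (row' ord0 x) < - x ord0 0 ->
  \forall y \near x, soc_proj y = 0.
Proof.
move=> /(cvg_lt_near (@tl_enorm_cvg x) (cvgN (@hd_cvg x))) xK; near=> y.
apply/soc_moreauP/soc_moreau_polar; rewrite /soc/= linearN/= enormN mxE.
by apply/ltW; near: y; exact: xK.
Unshelve. all: by end_near. Qed.

Lemma soc_proj_slant_near x : `|x ord0 0| < enorm (row' ord0 x) ->
  \forall y \near x, soc_proj y = soc_slant y.
Proof.
move=> /(cvg_lt_near (cvg_norm (@hd_cvg x)) (@tl_enorm_cvg x)) xK; near=> y.
apply/soc_moreauP/soc_moreau_slant; near: y; exact: xK.
Unshelve. all: by end_near. Qed.

End SecondOrderConeDifferential.

(** * The B-subdifferential of the projection *)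

Section SecondOrderConeBsubdiff.
Context {R : realType} {n : nat}.
Implicit Types (x y z p h : 'cV[R]_n.+1) (V : 'M[R]_n.+1).

Lemma cst_Bsubdiff (F : 'cV[R]_n.+1 -> 'cV[R]_n.+1) (x_ : nat -> 'cV[R]_n.+1)
    x V :
  x_ k @[k --> \oo] --> x ->
  (forall k, differentiable F (x_ k) /\
     'd F (x_ k) = (fun h => V *m h) :> ('cV[R]_n.+1 -> 'cV[R]_n.+1)) ->
  Bsubdiff F x V.
Proof.
move=> xx Fx; exists x_; split=> // [k|]; first by have [] := Fx k.
rewrite (_ : (fun k => _) = fun=> V); first exact: cvg_cst.
apply/funext => k; apply/matrixP => i j; rewrite mxE; have [_ ->] := Fx k.
by rewrite -colE mxE.
Qed.

(** Approach along the axis: s = 1 enters the interior of the cone from any of its points, and s =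
    -1 that of the polar. *)
Let cvg_shift_e0 x (s : R) :
  x + (s * harmonic k) *: delta_mx ord0 0 @[k --> \oo] --> x.
Proof.
rewrite -[X in _ --> X]addr0 -(scale0r (delta_mx ord0 0)) -(mulr0 s).
apply: cvgD; first exact: cvg_cst.
apply: cvgZr_tmp; apply: cvgM; [exact: cvg_cst | exact: cvg_harmonic].
Qed.

Let row'_shift_e0 x (c : R) : row' ord0 (x + c *: delta_mx ord0 0) = row' ord0 x.
Proof. by apply/matrixP => i j; rewrite !mxE/= mulr0 addr0. Qed.

Lemma Bsubdiff_soc_proj_nonempty x : Bsubdiff (@soc_proj R n) x !=set0.
Proof.
have [xK|xNK] := leP (enorm (row' ord0 x)) (x ord0 0).
  exists 1%:M; apply: (cst_Bsubdiff (@cvg_shift_e0 x 1)) => k.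
  set xk := x + _; have id_diff : is_diff xk id id by exact: is_diff_id.
  have id_near : \forall y \near xk, soc_proj y = id y.
    apply: soc_proj_id_near; rewrite row'_shift_e0 !mxE/= mulr1 mul1r.
    by rewrite (le_lt_trans xK)// ltrDl.
  have [dP ->] := near_eq_diff id_near (@ex_diff _ _ _ _ _ _ _ id_diff).
  split; first exact: dP.
  by apply/funext => h; rewrite mul1mx diff_val.
have [xpolar|xNpolar] := leP (enorm (row' ord0 x)) (- x ord0 0).
  exists 0; apply: (cst_Bsubdiff (@cvg_shift_e0 x (-1))) => k.
  set xk := x + _.
  have cst_near : \forall y \near xk, soc_proj y = cst 0 y.
    apply: soc_proj_polar_near; rewrite row'_shift_e0 !mxE/= mulr1 mulN1r.
    by rewrite (le_lt_trans xpolar)// opprB ltrDr.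
  have [dP ->] := near_eq_diff cst_near (differentiable_cst _ _).
  split; first exact: dP.
  by apply/funext => h; rewrite mul0mx diff_cst.
have x0 : `|x ord0 0| < enorm (row' ord0 x).
  by rewrite ltr_norml xNK ltrNl xNpolar.
have slant_diff : differentiable (@soc_slant R n) x.
  by apply: soc_slant_diff; apply: contraTneq x0 => ->; rewrite enorm0 -leNgt.
have [dP _] := near_eq_diff (soc_proj_slant_near x0) slant_diff.
exists (jacMv (@soc_proj R n) x); exists (fun=> x).
by split=> [_||]; [exact: dP | exact: cvg_cst | exact: cvg_cst].
Qed.

Lemma cvg_enorm0 (x_ : nat -> 'cV[R]_n.+1) x :
  x_ k @[k --> \oo] --> x -> enorm (x_ k - x) @[k --> \oo] --> 0.
Proof.
move=> xx; rewrite -(enorm0 (n := n.+1)) -(subrr x).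
by apply: cvg_enorm => i; apply: cvg_coord; apply: cvgB => //; exact: cvg_cst.
Qed.

Lemma soc_proj_lipschitz x y : enorm (soc_proj x - soc_proj y) <= enorm (x - y).
Proof. exact/firm_enorm/soc_proj_firm. Qed.

(** Firmness at x + t h and x, divided by t^2, is the inequality for difference quotients; let t
    tend to 0. *)
Lemma jac_soc_proj_firm x h : differentiable (@soc_proj R n) x ->
  let V := jacMv (@soc_proj R n) x in dotv (V *m h) (V *m h) <= dotv (V *m h) h.
Proof.
move=> dP /=; rewrite -jacMv_mul -deriveE//.
have := diff_derivable (v := h) dP.
set q := fun t : R => t^-1 *: (soc_proj (t *: h + x) - soc_proj x).
move=> qP; have {}qP : q @ 0^' --> 'D_h (@soc_proj R n) x by [].
have qi i : q t i 0 @[t --> 0^'] --> 'D_h (@soc_proj R n) x i 0.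
  exact: cvg_coord qP.
apply: (ler_cvg_to (cvg_dotv qi qi) (cvg_dotv qi (fun i => cvg_cst (h i 0)))).
near=> t; have t0 : t != 0 by near: t; exact: nbhs_dnbhs_neq.
have := soc_proj_firm (t *: h + x) x.
rewrite addrK dotvZr /q dotvZl dotvZr dotvZl => tP.
have ti2 : 0 <= t^-1 * t^-1 by rewrite -expr2 sqr_ge0.
have := ler_wpM2l ti2 tP.
by rewrite mulrA [X in _ <= X -> _]mulrA -[_ * t]mulrA mulVf// mulr1.
Unshelve. all: by end_near. Qed.

(** Euler's identity: by homogeneity the difference quotient at x in the direction x is constant as
    soon as t >= -1 and t != 0. *)
Lemma jac_soc_proj_mul x : differentiable (@soc_proj R n) x ->
  jacMv (@soc_proj R n) x *m x = soc_proj x.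
Proof.
move=> dP; rewrite -jacMv_mul -deriveE//; apply: cvg_lim => //.
apply: cvg_near_cst; near=> t.
have t0 : t != 0 by near: t; exact: nbhs_dnbhs_neq.
have t1 : 0 <= t + 1.
  near: t; apply: nbhs_dnbhs.
  have : (0 : R) > -1 by rewrite ltrN10.
  by move=> /lt_nbhsr; apply: filterS => u; lra.
rewrite /=; have -> : t *: x + x = (t + 1) *: x by rewrite scalerDl scale1r.
by rewrite soc_projZ// scalerDl scale1r addrK scalerA mulVf// scale1r.
Unshelve. all: by end_near. Qed.

Lemma Bsubdiff_soc_proj_firm x V h : Bsubdiff (@soc_proj R n) x V ->
  dotv (V *m h) (V *m h) <= dotv (V *m h) h.
Proof.
case=> x_ [dP xx VV].
have Vh i : (jacMv (@soc_proj R n) (x_ k) *m h) i 0 @[k --> \oo] --> (V *m h) i 0.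
  exact: cvg_mulmx_coord VV (cvg_cst h).
apply: (ler_cvg_to (cvg_dotv Vh Vh) (cvg_dotv Vh (fun i => cvg_cst (h i 0)))).
by apply: nearW => k; exact: jac_soc_proj_firm.
Qed.

(** Euler's identity holds along the approximating sequence, and nonexpansiveness of the projection
    identifies the limit of its right-hand side. *)
Lemma Bsubdiff_soc_proj_mul x V : Bsubdiff (@soc_proj R n) x V ->
  V *m x = soc_proj x.
Proof.
case=> x_ [dP xx VV]; apply/colP => i.
have : (jacMv (@soc_proj R n) (x_ k) *m x_ k) i 0 @[k --> \oo] --> (V *m x) i 0.
  exact: cvg_mulmx_coord VV xx.
under eq_cvg do rewrite (jac_soc_proj_mul (dP _)).
move=> PV; apply: (cvg_unique _ PV) => //.
apply/cvgrPdist_le => e e0; near=> k.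
have le_xk : enorm (x_ k - x) <= e.
  near: k; exact: cvgr_le (cvg_enorm0 xx) _ e0.
rewrite (le_trans _ le_xk)// (le_trans _ (soc_proj_lipschitz _ _))//.
by rewrite distrC (le_trans _ (coord_le_enorm _ i))// !mxE.
Unshelve. all: by end_near. Qed.

End SecondOrderConeBsubdiff.

(** * Norm bounds for symmetric positive definite matrices, without eigenvalues *)

Section SymmetricMatrices.
Context {R : realType} {n : nat}.
Implicit Types (x y z h : 'cV[R]_n.+1) (M B V : 'M[R]_n.+1).

Lemma unitmx_ker0 m (A : 'M[R]_m) :
  (forall h : 'cV[R]_m, A *m h = 0 -> h = 0) -> A \in unitmx.
Proof.
move=> A0; rewrite -unitmx_tr -row_free_unit; apply: inj_row_free => v vA.
apply: trmx_inj; rewrite trmx0; apply: A0.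
by rewrite -[A]trmxK -trmx_mul vA trmx0.
Qed.

(* Polarization: the numerical range of a symmetric matrix bounds its norm. *)
Lemma symmx_enorm_le B c : B^T = B -> 0 < c ->
  (forall x, `|dotv (B *m x) x| <= c * dotv x x) ->
  forall x, enorm (B *m x) <= c * enorm x.
Proof.
move=> Bsym c0 Bc x; rewrite enorm_le; last by rewrite mulr_ge0 ?enorm_ge0// ltW.
(* For this v, subtracting the bounds at x + v and x - v gives 4 X/c <= 2 c |x|^2 + 2 X/c, hence X
   <= c^2 |x|^2. *)
pose v := c^-1 *: (B *m x); set X := dotv (B *m x) (B *m x).
have xv : dotv (B *m x) v = c^-1 * X by rewrite dotvZr.
have vv : c * dotv v v = c^-1 * X by rewrite dotvZr dotvZl mulVKf ?gt_eqF.
have vx : dotv (B *m v) x = c^-1 * X by rewrite dotv_mxl Bsym dotvC.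
clearbody v; have := Bc (x + v); have := Bc (x - v); rewrite !ler_norml.
rewrite mulmxBr mulmxDr !dotvE xv vx (dotvC v x).
move=> /andP[h1 _] /andP[_ h2].
have : c^-1 * X <= c * dotv x x by lra.
by rewrite ler_pdivrMl// mulrA -expr2 -enorm_sqr -exprMn.
Qed.

Lemma posdefmx_unit M : posdefmx M -> M \in unitmx.
Proof.
move=> Mpd; apply: unitmx_ker0 => h Mh; apply/eqP; apply/negPn/negP => h0.
by have := Mpd h h0; rewrite Mh dotv0l ltxx.
Qed.

Lemma posdefmx_ge0 M x : posdefmx M -> 0 <= dotv (M *m x) x.
Proof.
move=> Mpd; have [->|x0] := eqVneq x 0; first by rewrite mulmx0 dotv0l.
exact/ltW/Mpd.
Qed.

Lemma dotv_mx_le_opnorm M x : dotv (M *m x) x <= opnorm M * dotv x x.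
Proof.
rewrite (le_trans (dotv_le_enorm _ _))// -enorm_sqr expr2 mulrA.
by rewrite ler_wpM2r ?enorm_ge0 ?enorm_mulmx.
Qed.

(* With nu = opnorm (invmx M), the value of M at x - nu^-1 (invmx M) x is
   nonnegative, which is Cauchy-Schwarz for the inner product defined by M. *)
Lemma posdefmx_lower M x : M^T = M -> posdefmx M ->
  dotv x x <= opnorm (invmx M) * dotv (M *m x) x.
Proof.
move=> Msym Mpd; set nu := opnorm _; have Mu := posdefmx_unit Mpd.
have [->|x0] := eqVneq x 0; first by rewrite mulmx0 !dotv0l mulr0.
have xx : 0 < dotv x x by rewrite -enorm_sqr exprn_gt0 ?enorm_gt0.
have MVx : M *m (invmx M *m x) = x by rewrite mulmxA mulmxV// mul1mx.
have nuP := dotv_mx_le_opnorm (invmx M) x; rewrite -/nu in nuP.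
have nu0 : 0 < nu.
  rewrite -(pmulr_lgt0 _ xx) (lt_le_trans _ nuP)// -{2}MVx dotvC.
  apply: Mpd; apply: contra_neq x0 => h; by rewrite -MVx h mulmx0.
have := posdefmx_ge0 (x - nu^-1 *: (invmx M *m x)) Mpd.
rewrite mulmxBr -scalemxAr MVx !dotvE (dotv_mxl M x (invmx M *m x)) Msym MVx.
rewrite (dotvC x (invmx M *m x)) => h.
have nuV : nu^-1 * (nu^-1 * dotv (invmx M *m x) x) <= nu^-1 * dotv x x.
  rewrite ler_pM2l ?invr_gt0// ler_pdivrMl//.
have {}h : nu^-1 * dotv x x <= dotv (M *m x) x by lra.
by rewrite -ler_pdivrMl.
Qed.

(** The two hypotheses on beta bound the numerical range of beta M - Id from above and from below by
    c and -c; symmetry turns this into a norm bound. *)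
Lemma opnorm_scale_sub1 M beta c : M^T = M -> posdefmx M -> 0 < beta -> 0 < c ->
  beta * opnorm M <= 1 + c -> (1 - c) * opnorm (invmx M) <= beta ->
  opnorm (beta *: M - 1%:M) <= c.
Proof.
move=> Msym Mpd beta0 c0 Mle Mge; apply: opnorm_le; apply: symmx_enorm_le => //.
  by rewrite linearB linearZ/= Msym trmx1.
move=> x; rewrite mulmxBl mul1mx -scalemxAl !dotvE ler_norml.
have xx := dotv_ge0 x; have Mx := posdefmx_ge0 x Mpd.
have h1 := dotv_mx_le_opnorm M x; have h2 := posdefmx_lower x Msym Mpd.
apply/andP; split; last by nra.
(* If c > 1, the lower bound follows from <M x, x> >= 0 alone; otherwise [posdefmx_lower] is
   multiplied by 1 - c >= 0. *)
have [c1|c1] := leP c 1; last by nra.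
have : (1 - c) * dotv x x <= (1 - c) * opnorm (invmx M) * dotv (M *m x) x.
  by rewrite -mulrA ler_wpM2l// subr_ge0.
have := ler_wpM2r Mx Mge; lra.
Qed.

Let e0_neq0 : (delta_mx ord0 0 : 'cV[R]_n.+1) != 0.
Proof.
apply/negP => /eqP e0; have := @dotv_delta R n.
by rewrite e0 dotv0l => /esym/eqP; rewrite oner_eq0.
Qed.

Lemma posdefmx_opnorm_gt0 M : posdefmx M -> 0 < opnorm M.
Proof.
move=> Mpd; have := dotv_mx_le_opnorm M (delta_mx ord0 0).
by rewrite dotv_delta mulr1; apply: lt_le_trans (Mpd _ e0_neq0).
Qed.

Lemma posdefmx_opnorm_inv_gt0 M : M^T = M -> posdefmx M -> 0 < opnorm (invmx M).
Proof.
move=> Msym Mpd; have := posdefmx_lower (delta_mx ord0 0) Msym Mpd.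
rewrite dotv_delta => /(lt_le_trans ltr01).
by rewrite (pmulr_lgt0 _ (Mpd _ e0_neq0)).
Qed.

End SymmetricMatrices.

(** * Geometric convergence and fixed points of Euclidean contractions *)

(** The increments form an absolutely convergent series, whose partial sums telescope. *)
Lemma geometric_increments_cvg (R : realType) (x_ : nat -> R) (a c : R) :
  0 <= c < 1 -> 0 <= a ->
  (forall k, `|x_ k.+1 - x_ k| <= a * c ^+ k) -> cvgn x_.
Proof.
move=> /andP[c0 c1] a0 x_le; pose u_ k := x_ k.+1 - x_ k.
have un : cvgn [normed series u_].
  apply: (@series_le_cvg R _ (geometric a c)) => [k|k|k|].
  - exact: normr_ge0.
  - by rewrite mulr_ge0 ?exprn_ge0.
  - exact: x_le.
  - by apply: is_cvg_geometric_series; rewrite ger0_norm.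
have /cvg_ex[l ul] := normed_cvg un.
apply/cvg_ex; exists (l + x_ 0%N).
have xE : series u_ \+ cst (x_ 0%N) = x_.
  by apply/funext => k; rewrite /series/= telescope_sumr// subrK.
by rewrite -[X in X @ _]xE; apply: cvgD ul _; exact: cvg_cst.
Qed.

Section EuclideanContraction.
Context {R : realType} {n : nat}.
Implicit Types (x y z : 'cV[R]_n.+1).

Lemma geometric_enorm_cvg (y_ : nat -> 'cV[R]_n.+1) y c : 0 <= c < 1 ->
  (forall k, enorm (y - y_ k.+1) <= c * enorm (y - y_ k)) ->
  y_ k @[k --> \oo] --> y.
Proof.
move=> /andP[c0 c1] yc.
have yk k : enorm (y - y_ k) <= geometric (enorm (y - y_ 0%N)) c k.
  elim: k => [|k IH]; first by rewrite /= expr0 mulr1.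
  rewrite (le_trans (yc k))//= exprS mulrCA ler_wpM2l//.
have geo : geometric (enorm (y - y_ 0%N)) c @ \oo --> 0.
  by apply: cvg_geometric; rewrite ger0_norm.
apply/cvgrPdist_le => e e0; near=> k.
rewrite (le_trans (norm_le_enorm _))// (le_trans (yk k))//.
by near: k; exact: cvgr_le geo _ e0.
Unshelve. all: by end_near. Qed.

(** Banach's theorem for the Euclidean norm; a contraction for it need not be one for the max norm.
    The Picard iterates from 0 converge in each coordinate. *)
Lemma enorm_contraction_fixpoint (f : 'cV[R]_n.+1 -> 'cV[R]_n.+1) c :
  0 <= c < 1 -> (forall y z, enorm (f y - f z) <= c * enorm (y - z)) ->
  exists y, f y = y.
Proof.
move=> c01 fc; have /andP[c0 c1] := c01.
pose x_ k : 'cV[R]_n.+1 := iter k f 0; set d := enorm (x_ 1%N - x_ 0%N).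
have x_le k : enorm (x_ k.+1 - x_ k) <= d * c ^+ k.
  elim: k => [|k IH]; first by rewrite expr0 mulr1.
  by rewrite (le_trans (fc _ _))// exprS mulrCA ler_wpM2l.
have x_cvg i : cvgn (fun k => x_ k i 0).
  apply: (geometric_increments_cvg c01 (enorm_ge0 (x_ 1%N - x_ 0%N))) => k.
  by rewrite (le_trans _ (x_le k))// (le_trans _ (coord_le_enorm _ i))// !mxE.
have [l xl] : exists l : 'cV[R]_n.+1,
    forall i, x_ k i 0 @[k --> \oo] --> l i 0.
  by exists (\col_i limn (fun k => x_ k i 0)) => i; rewrite mxE; exact: x_cvg.
have l0 : enorm (x_ k - l) @[k --> \oo] --> 0.
  rewrite -(@enorm0 R n.+1) -(subrr l); apply: cvg_enorm => i.
  under eq_cvg do rewrite !mxE; rewrite !mxE.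
  by apply: cvgB (xl i) _; exact: cvg_cst.
exists l; apply/eqP; rewrite -subr_eq0; apply/eqP/enorm0_eq0/le_anti.
rewrite enorm_ge0 andbT.
have l1 : enorm (x_ k.+1 - l) @[k --> \oo] --> 0.
  by move: l0; rewrite -(@cvg_shiftS _ (fun k => enorm (x_ k - l))).
(* This sum bounds |f l - l|, since |x_{k+1} - f l| <= |x_k - l|. *)
have l01 : enorm (x_ k - l) + enorm (x_ k.+1 - l) @[k --> \oo] --> 0.
  by rewrite -[X in _ --> X]addr0; exact: cvgD l0 l1.
apply: (cvgr_to_ge l01); apply: nearW => k /=.
rewrite (_ : f l - l = - (x_ k.+1 - f l) + (x_ k.+1 - l)); last first.
  by rewrite opprB addrA subrK.
rewrite (le_trans (enormD _ _))// lerD2r enormN (le_trans (fc _ _))//.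
by rewrite ler_piMl ?enorm_ge0 ?ltW.
Qed.

End EuclideanContraction.

(** * Nonsingularity and error of one Newton step *)

Section NewtonStep.
Context {R : realType} {n : nat}.
Implicit Types (x y z h : 'cV[R]_n.+1) (M V : 'M[R]_n.+1).

Lemma newton_mx_unit Mb V : posdefmx Mb ->
  (forall h, dotv (V *m h) (V *m h) <= dotv (V *m h) h) ->
  newton_mx Mb V \in unitmx.
Proof.
move=> Mpd Vfirm; apply: unitmx_ker0 => h.
rewrite /newton_mx mulmxDl mul1mx -mulmxA mulmxBl mul1mx => Nh.
(* Pairing this with u = V h gives <Mb u, u> = |u|^2 - <u, h> <= 0, so u = 0, and the kernel
   equation leaves h = 0. *)
have Mu : Mb *m (V *m h) = V *m h - h.
  by apply/eqP; rewrite -subr_eq0 opprB addrA addrAC Nh.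
have Vh0 : V *m h = 0.
  apply/eqP/negPn/negP => /Mpd; rewrite Mu !dotvE (dotvC h).
  by have := Vfirm h; lra.
by move: Nh; rewrite Vh0 mulmx0 subr0 add0r.
Qed.

(** For d = x - y, both V d and P(x) - P(y) lie in the ball with centre d/2 and radius |d|/2, whose
    diameter is |d|. *)
Lemma soc_proj_newton_error x y V : Bsubdiff (@soc_proj R n) y V ->
  enorm (V *m x - soc_proj x) <= enorm (x - y).
Proof.
move=> dV; set d := x - y.
have -> : V *m x - soc_proj x =
    (V *m d - 2^-1 *: d) - (soc_proj x - soc_proj y - 2^-1 *: d).
  rewrite /d mulmxBr (Bsubdiff_soc_proj_mul dV).
  by apply/matrixP => i j; rewrite !mxE; ring.
rewrite (le_trans (enormD _ _))// enormN.
have := firm_half_enorm (Bsubdiff_soc_proj_firm d dV).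
have := firm_half_enorm (soc_proj_firm x y); rewrite -/d; lra.
Qed.

Lemma newton_step_error Mb b y z ystar : opnorm (Mb - 1%:M) < 1 ->
  projection_eqn Mb b ystar -> newton_step Mb b y z ->
  enorm (ystar - z) <=
    opnorm (Mb - 1%:M) / (1 - opnorm (Mb - 1%:M)) * enorm (ystar - y).
Proof.
rewrite /projection_eqn /newton_mx; set G := Mb - 1%:M => r1 ystarE [V dV].
rewrite /newton_mx -/G -{1}ystarE mulmxDl mul1mx -mulmxA => zE.
set w := ystar - z.
(* Difference of the equation for [ystar] and the Newton system. Since |V w| <= |w|, it gives |w| <=
   r (|ystar - y| + |w|) with r = [opnorm G], which is solved for |w|. *)
have wE : w = G *m ((V *m ystar - soc_proj ystar) - V *m w).
  have -> : V *m ystar - soc_proj ystar - V *m w = V *m z - soc_proj ystar.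
    by rewrite /w mulmxBr opprB addrC addrA subrK.
  have -> : G *m (V *m z - soc_proj ystar) = G *m soc_proj ystar + ystar - z -
      G *m soc_proj ystar by rewrite mulmxBr -zE addrK.
  by rewrite -[X in _ = X - _]addrA [X in _ = X - _]addrC addrK.
have : enorm w <= opnorm G * (enorm (ystar - y) + enorm w).
  rewrite {1}wE (le_trans (enorm_mulmx _ _))// ler_wpM2l ?opnorm_ge0//.
  rewrite (le_trans (enormD _ _))// enormN lerD ?soc_proj_newton_error//.
  exact/firm_enorm/(Bsubdiff_soc_proj_firm _ dV).
move=> wle; rewrite mulrAC ler_pdivlMr ?subr_gt0//; lra.
Qed.

End NewtonStep.

Theorem theorem6 (R : realType) (n : nat) (q : 'cV[R]_n.+1) (M : 'M[R]_n.+1)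
    (beta : R) (Msym : M^T = M) (Mpd : posdefmx M) (beta_gt0 : 0 < beta) :
  let Mb : 'M[R]_n.+1 := beta *: M in
  let b : 'cV[R]_n.+1 := - (beta *: q) in
  let r : R := opnorm (Mb - 1%:M) in
  (forall y0 : 'cV[R]_n.+1, newton_well_defined Mb b y0) /\
  (beta < 2 / opnorm M ->
    (exists! ystar : 'cV[R]_n.+1, projection_eqn Mb b ystar) /\
    forall ystar : 'cV[R]_n.+1, projection_eqn Mb b ystar ->
      (opnorm M * opnorm (invmx M) < 3 ->
       2^-1 * opnorm (invmx M) < beta ->
       beta < 3 / 2 * (1 / opnorm M) ->
       forall y : nat -> 'cV[R]_n.+1, newton_seq Mb b y ->
         Qlinear_cvg y ystar /\
         forall k : nat, enorm (ystar - y k.+1) <=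
                         r / (1 - r) * enorm (ystar - y k)) /\
      lsoccp_sol M q (soc_proj ystar)).
Proof.
move=> Mb b r.
have Mbpd : posdefmx Mb.
  by move=> x x0; rewrite -scalemxAl dotvZl mulr_gt0 ?Mpd.
have mu0 := posdefmx_opnorm_gt0 Mpd.
have nu0 := posdefmx_opnorm_inv_gt0 Msym Mpd.
have r_lt c : 0 < c -> c <= 1 -> beta * opnorm M < 1 + c ->
    (1 - c) * opnorm (invmx M) < beta -> r < c.
  move=> c0 c1 h1 h2.
  (* [opnorm_scale_sub1] yields only a weak inequality, so it is applied to a constant below c: its
     two conditions solved for the constant, with c/2 to keep it positive. *)
  pose c' := Num.max (Num.max (beta * opnorm M - 1)
                              (1 - beta / opnorm (invmx M))) (c / 2).
  apply: (@le_lt_trans _ _ c').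
    apply: opnorm_scale_sub1 => //.
    - by rewrite lt_max; apply/orP; right; lra.
    - by rewrite -lerBlDl !le_max lexx.
    - rewrite -ler_pdivlMr// lerBlDr -lerBlDl !le_max lexx orbT//.
  rewrite !gt_max; apply/andP; split; last by lra.
  apply/andP; split; first by lra.
  by rewrite ltrBlDr -ltrBlDl ltr_pdivlMr.
split=> [y0 k y _ _|].
  split=> [|V dV]; first exact: Bsubdiff_soc_proj_nonempty.
  have Nu : newton_mx Mb V \in unitmx.
    by apply: newton_mx_unit => // h; exact: Bsubdiff_soc_proj_firm dV.
  split=> //; exists (invmx (newton_mx Mb V) *m b); split.
    by rewrite mulmxA mulmxV// mul1mx.
  by move=> z <-; rewrite mulmxA mulVmx// mul1mx.
rewrite ltr_pdivlMr// => beta_lt.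
(* For c = 1 the lower condition of [r_lt] reduces to 0 < beta. *)
have r1 : r < 1 by apply: r_lt => //; rewrite ?subrr ?mul0r; lra.
have r0 : 0 <= r := opnorm_ge0 _.
(* Solutions of the equation are the fixed points of y |-> b - (Mb - Id) P(y), an r-contraction. *)
have G_lip y z : enorm ((b - (Mb - 1%:M) *m soc_proj y) -
    (b - (Mb - 1%:M) *m soc_proj z)) <= r * enorm (y - z).
  have -> : b - (Mb - 1%:M) *m soc_proj y - (b - (Mb - 1%:M) *m soc_proj z) =
      - ((Mb - 1%:M) *m (soc_proj y - soc_proj z)).
    by rewrite mulmxBr !opprB [LHS]addrC addrA subrK.
  rewrite enormN (le_trans (enorm_mulmx _ _))//.
  by rewrite ler_wpM2l// soc_proj_lipschitz.
split.
  have [|ystar ystarE] := enorm_contraction_fixpoint (c := r) _ G_lip.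
    by rewrite r0 r1.
  exists ystar; split=> [|y yE].
    by rewrite /projection_eqn -{2}ystarE addrC subrK.
  have yE' : b - (Mb - 1%:M) *m soc_proj y = y by rewrite -yE addrC addKr.
  apply/eqP; rewrite -subr_eq0; apply/eqP/enorm0_eq0.
  have := G_lip ystar y; rewrite ystarE yE'.
  have := enorm_ge0 (ystar - y); nra.
move=> ystar ystarE; split=> [_ nu_lt|].
  rewrite div1r ltr_pdivlMr// => mu_lt y yN.
  (* For c = 1/2 the conditions of [r_lt] are the two bounds on beta; r < 1/2 is what makes r / (1 -
     r) less than 1. *)
  have r2 : r < 2^-1 by apply: r_lt; lra.
  have yQ k : enorm (ystar - y k.+1) <= r / (1 - r) * enorm (ystar - y k).
    exact: newton_step_error r1 ystarE (yN k).
  have c01 : 0 <= r / (1 - r) < 1.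
    by rewrite divr_ge0 ?ltr_pdivrMr ?mul1r; lra.
  split=> //; split; first exact: geometric_enorm_cvg c01 yQ.
  by exists (r / (1 - r)) => //; exact: nearW.
have [pK pyK py0] := soc_proj_moreau ystar.
set z := soc_proj ystar in pK pyK py0 *.
(* The equation rewritten: up to the factor 1/beta, M z + q is the second component of the Moreau
   decomposition of [ystar], so membership and orthogonality carry over. *)
have zE : M *m z + q = beta^-1 *: (z - ystar).
  apply: (@scalerI _ _ beta); first by rewrite gt_eqF.
  rewrite scalerA mulfV ?gt_eqF// scale1r scalerDr scalemxAl.
  have := ystarE; rewrite /projection_eqn -/z mulmxBl mul1mx /b => h.
  rewrite -[beta *: q]opprK -h.
  by apply/matrixP => i j; rewrite !mxE; ring.
rewrite /lsoccp_sol zE; split=> //.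
  by apply: socZ => //; rewrite invr_ge0 ltW.
by rewrite dotvZl py0 mulr0.
Qed.
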